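(* Let $G' = \{p^2 : p \text{ prime}\}$ be the set of squares of primes, so that the Beurling integers generated by $G'$ are the perfect squares $\{n^2 : n\ge 1\}$. Then there exist infinitely many numbers $\alpha\in\mathbb{R}\setminus\mathbb{Z}$, $\alpha>1$, such that for $G = G'\cup\{\alpha\}$ the Beurling integers $b_0=1\le b_1\le\dots$ generated by $G$ satisfy $b_{i+1}-b_i\ge 1$ for all $i$. The set of all such numbers $\alpha$ has Lebesgue measure $0$.
   Context: For a sequence $G=\{g_1,g_2,\dots\}$ of real numbers with $1<g_1\le g_2\le\dots$ (the generators), the associated Beurling integers are the sequence $B=\{b_0,b_1,b_2,\dots\}$, $b_0=1\le b_1\le b_2\le\dots$, consisting of all finite products of elements of $G$ (repetitions of factors allowed, the empty product being $1$), listed in nondecreasing order with multiplicity. *)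

(* Defs.v *)
From HB Require Import structures.
From mathcomp Require Export all_boot all_order all_algebra.
From mathcomp Require Export finmap multiset.
From mathcomp Require Export all_classical all_reals all_analysis.
Set Implicit Arguments.
Unset Strict Implicit.
Unset Printing Implicit Defensive.
Import Order.TTheory GRing.Theory Num.Theory.
Local Open Scope classical_set_scope.
Local Open Scope mset_scope.
Local Open Scope ring_scope.

Definition generator_seq (R : realType) (g : nat -> R) : Prop :=
  1 < g 0%N /\ {homo g : m n / (m <= n)%N >-> m <= n}.

(* A formal product of generators, repetitions allowed, is a finite multiset
   of indices; the bijection makes b list every formal product exactly once,
   so that distinct products with the same value are counted separately. *)
Definition beurling_integers (R : realType) (g b : nat -> R) : Prop :=
  {homo b : m n / (m <= n)%N >-> m <= n} /\
  exists phi : nat -> {mset nat},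
    bijective phi /\ forall n, b n = \prod_(i <- phi n) g i.

(* G is viewed as a generator sequence by listing each element once. *)
Definition beurling_integers_of (R : realType) (G : set R) (b : nat -> R)
    : Prop :=
  exists g : nat -> R,
    [/\ generator_seq g, injective g, range g = G & beurling_integers g b].

Definition prime_squares (R : realType) : set R :=
  [set p%:R ^+ 2 | p in [set p : nat | prime p]].
Arguments prime_squares : clear implicits.

Definition well_spaced (R : realType) (b : nat -> R) : Prop :=
  forall i, 1 <= b i.+1 - b i.

Definition spacing_preserving (R : realType) (G : set R) : set R :=
  [set alpha : R | [/\ alpha \isn't a Num.int, 1 < alpha &
     exists2 b : nat -> R,
       beurling_integers_of (G `|` [set alpha]) b & well_spaced b]].

(* Main.v *)
(* Every product of generators is alpha^k n^2, so alpha is admissible iff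
   |alpha^j n^2 - m^2| >= 1 for all j, n, m >= 1.

   If x > y > 0, xy = 1 and x + y = t >= 3 is an integer, then alpha = x^2
   qualifies: |x^j n - m| (x^j n + m) >= |(x^j n - m) (y^j n - m)|, and the right
   side is |n^2 - T n m + m^2| with T = x^j + y^j an integer >= 3, hence a
   nonzero integer.

   For measure zero only j = 2 is needed: |(alpha n)^2 - m^2| >= 1 makes alpha
   badly approximable. Around any point, Dirichlet's theorem yields
   arbitrarily small balls of which the set misses a fixed proportion, so
   it has no density points. *)
From mathcomp Require Import measurable_realfun zify ring lra.
Require Import Defs.
Set Implicit Arguments.
Unset Strict Implicit.
Unset Printing Implicit Defensive.
Import Order.TTheory GRing.Theory Num.Theory.
Import numFieldNormedType.Exports.
Local Open Scope classical_set_scope.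
Local Open Scope ring_scope.

(** * Enumerations *)

(** Iterating [next], the least element of [T] at or above a bound, never skips an element of
    [T]. *)
Lemma enum_infinite_nat (T : set nat) :
  (forall k, exists2 j, T j & (k < j)%N) ->
  exists f : nat -> nat, {homo f : m n / (m < n)%N} /\ range f = T.
Proof.
move=> Tinf.
have ext k : exists j, `[< T j >] && (k <= j)%N.
  by have [j Tj kj] := Tinf k; exists j; rewrite (ltnW kj) andbT; exact/asboolP.
pose next k := ex_minn (ext k).
pose f := fix f n := if n is m.+1 then next (f m).+1 else next 0%N.
have nextT k : T (next k).
  by rewrite /next; case: ex_minnP => j /andP[/asboolP].
have next_ge k : (k <= next k)%N.
  by rewrite /next; case: ex_minnP => j /andP[].
have next_le k j : T j -> (k <= j)%N -> (next k <= j)%N.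
  move=> Tj kj; rewrite /next; case: ex_minnP => m _; apply.
  by rewrite kj andbT; exact/asboolP.
have fincr : {homo f : m n / (m < n)%N}.
  by apply: homo_ltn => [? ? ?|n]; [exact: ltn_trans|exact: next_ge].
have f_ge n : (n <= f n)%N.
  by elim: n => // n /leq_ltn_trans; apply; exact: fincr.
exists f; split=> //; apply/seteqP; split=> [_ [n _ <-]|j Tj].
  by case: n => [|n]; exact: nextT.
(* At the least index whose value is at least [j], the previous value is still below [j], so [next]
   stops at [j] exactly. *)
have [|[|n] fn_ge min_n] := ex_minnP (ex_intro (fun n => j <= f n)%N j _) => //.
  by exists 0%N => //; apply/eqP; rewrite eqn_leq fn_ge andbT next_le.
exists n.+1 => //; apply/eqP; rewrite eqn_leq fn_ge andbT next_le// ltnNge.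
by apply/negP => /min_n; rewrite ltnn.
Qed.

Lemma truncn_eq_lt1 (R : realType) (x y : R) :
  0 <= y -> Num.truncn x = Num.truncn y -> x - y < 1.
Proof.
rewrite -truncn_le => y0 xy; have := truncnS_gt x; rewrite xy -natr1 => ?.
lra.
Qed.

Definition separated (R : realType) (S : set R) :=
  forall x y, S x -> S y -> x < y -> 1 <= y - x.

(** Two elements at distance at least 1 have different integer parts, so [truncn] is injective on
    [S] and the enumeration reduces to that of an infinite set of naturals. *)
Lemma enum_separated (R : realType) (S : set R) :
  (forall x, S x -> 0 <= x) -> (forall k : nat, exists2 x, S x & k%:R <= x) ->
  separated S ->
  exists b : nat -> R,
    [/\ {homo b : m n / (m < n)%N >-> m < n}, range b = S & well_spaced b].
Proof.
move=> S0 Sunb Ssep.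
have [k|f [fincr fS]] := @enum_infinite_nat (Num.truncn @` S).
  have [x Sx kx] := Sunb k.+1; exists (Num.truncn x); first by exists x.
  by rewrite -ltnS -truncn_ge_nat ?S0 in kx *.
have /choice[b bP] n : exists x, S x /\ Num.truncn x = f n.
  by have : range f (f n) by []; rewrite fS => -[x Sx xn]; exists x.
have bincr : {homo b : m n / (m < n)%N >-> m < n}.
  move=> m n /fincr; rewrite -(bP m).2 -(bP n).2 => ltmn.
  rewrite ltNge; apply/negP => /le_truncn.
  by rewrite leqNgt ltmn.
exists b; split => //.
- apply/seteqP; split=> [_ [n _ <-]|x Sx]; first exact: (bP n).1.
  have : (Num.truncn @` S) (Num.truncn x) by exists x.
  rewrite -fS => -[n _ fn]; exists n => //.
  have [Sb trb] := bP n; rewrite fn in trb.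
  apply/eqP; rewrite eq_le; apply/andP; split; rewrite leNgt; apply/negP.
  + move=> /(Ssep _ _ Sx Sb); apply/negP; rewrite -ltNge.
    by apply: truncn_eq_lt1; rewrite ?S0.
  + move=> /(Ssep _ _ Sb Sx); apply/negP; rewrite -ltNge.
    by apply: truncn_eq_lt1; rewrite ?S0.
- by move=> i; apply: Ssep; [exact: (bP _).1..|exact: bincr].
Qed.

(** When distinct formal products have distinct values, every multiplicity is one, and matching
    indices with multisets by value is the required bijection. *)
Lemma beurling_integers_inj (R : realType) (g b : nat -> R) :
  {homo b : m n / (m < n)%N >-> m < n} ->
  injective (fun A : {mset nat}%mset => \prod_(i <- A) g i) ->
  range (fun A : {mset nat}%mset => \prod_(i <- A) g i) = range b ->
  beurling_integers g b.
Proof.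
move=> bincr ginj gb.
have bmono : {mono b : m n / (m <= n)%N >-> m <= n}.
  exact/le_mono.
have binj : injective b := inc_inj bmono.
split=> [m n|]; first by rewrite bmono.
have /choice[phi phiP] n : exists A : {mset nat}%mset, b n = \prod_(i <- A) g i.
  by have : range b (b n) by []; rewrite -gb => -[A _ <-]; exists A.
have /choice[psi psiP] (A : {mset nat}%mset) : exists n, b n = \prod_(i <- A) g i.
  have : range b (\prod_(i <- A) g i) by rewrite -gb.
  by move=> [n _ <-]; exists n.
exists phi; split=> //; exists psi => [n|A].
  by apply: binj; rewrite psiP -phiP.
by apply: ginj; rewrite /= -phiP psiP.
Qed.

(** Valuations recover the multiplicities of the factors. The value 1 is allowed for [P] so that the
    index of an adjoined generator can contribute nothing to the integer factor. *)
Lemma logn_prod_seq (P : nat -> nat) (s : seq nat) i : injective P ->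
  (forall j, P j = 1%N \/ prime (P j)) -> prime (P i) ->
  logn (P i) (\prod_(j <- s) P j)%N = count_mem i s.
Proof.
move=> Pinj P1 Pi; have P0 j : (0 < P j)%N by case: (P1 j) => [->|/prime_gt0].
elim: s => [|j s IHs]; first by rewrite big_nil logn1.
rewrite big_cons lognM ?prodn_gt0// IHs/=; congr addn.
have [Pj|/logn_prime->] := P1 j; last by rewrite (inj_eq Pinj) eq_sym.
by rewrite Pj logn1; case: eqP => // ji; move: Pi; rewrite -ji Pj.
Qed.

(** Strong induction, splitting off the least prime divisor. The [all] clause keeps indices with
    [P i = 1] out of the factorization. *)
Lemma exists_prod_seq (P : nat -> nat) (n : nat) :
  (forall p, prime p -> exists i, P i = p) -> (0 < n)%N ->
  exists2 s : seq nat, all (fun i => prime (P i)) s & (\prod_(j <- s) P j)%N = n.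
Proof.
move=> Psurj; elim/ltn_ind: n => n IHn n0.
have [n1|] := leqP n 1.
  by exists [::] => //; rewrite big_nil; apply/eqP; rewrite eqn_leq n0.
move=> n1; have pr := pdiv_prime n1; have /dvdnP[m nE] := pdiv_dvd n.
have m0 : (0 < m)%N by case: m nE n0 => // ->.
have [|//|s sP sm] := IHn m.
  by rewrite nE ltn_Pmulr ?prime_gt1.
have [i Pi] := Psurj _ pr.
by exists (i :: s); rewrite /= ?Pi ?pr// big_cons sm Pi mulnC -nE.
Qed.

(** * Squares of primes generate the perfect squares *)

Lemma natr_separated (R : realType) (S : set R) :
  (forall x, S x -> exists n : nat, x = n%:R) -> separated S.
Proof.
move=> Snat x y /Snat[m ->] /Snat[n ->].
by rewrite ltr_nat => mn; rewrite lerBrDr addrC natr1 ler_nat.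
Qed.

Lemma prime_squares_unbounded (R : realType) (k : nat) :
  exists2 x, prime_squares R x & k%:R <= x.
Proof.
have [p kp pr] := prime_above k; exists (p%:R ^+ 2); first by exists p.
by rewrite -natrX ler_nat (leq_trans (ltnW kp))// -{1}(expn1 p) leq_pexp2l ?prime_gt0.
Qed.

Lemma prime_squares_gt1 (R : realType) (x : R) : prime_squares R x -> 1 < x.
Proof. by move=> [p /prime_gt1 p1 <-]; rewrite exprn_egt1// ltr1n. Qed.

(** Each product is the square of a product of primes, so existence and uniqueness of prime
    factorizations give surjectivity and injectivity. *)
Lemma beurling_integers_of_prime_squares (R : realType) :
  beurling_integers_of (prime_squares R) (fun n : nat => n.+1%:R ^+ 2).
Proof.
have [||g [gincr gG _]] := @enum_separated R (prime_squares R) _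
    (@prime_squares_unbounded R).
- by move=> x /prime_squares_gt1/(lt_trans ltr01)/ltW.
- by apply: natr_separated => _ [p _ <-]; exists (p ^ 2)%N; rewrite natrX.
have gmono : {mono g : m n / (m <= n)%N >-> m <= n} by exact/le_mono.
have ginj : injective g := inc_inj gmono.
have gG' n : prime_squares R (g n) by rewrite -gG; exists n.
exists g; split=> //.
  by split=> [|m n]; [exact: prime_squares_gt1|rewrite gmono].
have /choice[P PP] n : exists p, prime p /\ p%:R ^+ 2 = g n.
  by have [p pr <-] := gG' n; exists p.
have Pinj : injective P.
  by move=> m n Pmn; apply: ginj; rewrite -(PP m).2 -(PP n).2 Pmn.
have prodE (s : seq nat) : \prod_(i <- s) g i = (\prod_(i <- s) P i)%N%:R ^+ 2.
  elim: s => [|i s IHs]; first by rewrite !big_nil expr1n.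
  by rewrite !big_cons IHs natrM exprMn (PP i).2.
apply: beurling_integers_inj.
- by move=> m n mn; rewrite ltr_pXn2r ?nnegrE// ltr_nat ltnS.
- move=> A B; rewrite !prodE => /eqP; rewrite eqrXn2// eqr_nat => /eqP AB.
  apply/msetP => i; rewrite -!count_mem_mset.
  have Ppr j : P j = 1%N \/ prime (P j) by right; exact: (PP j).1.
  by rewrite -!(logn_prod_seq _ Pinj Ppr (PP i).1) AB.
- apply/seteqP; split=> [_ [A _ <-]|_ [n _ <-]].
    rewrite prodE; exists (\prod_(i <- A) P i).-1 => //.
    by rewrite prednK// prodn_gt0// => i; apply: prime_gt0; exact: (PP i).1.
  have [p pr|//|s _ sn] := @exists_prod_seq P n.+1.
    have : prime_squares R (p%:R ^+ 2) by exists p.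
    rewrite -gG => -[i _ gi]; exists i.
    by move: (PP i).2; rewrite gi => /eqP; rewrite eqrXn2// eqr_nat => /eqP.
  exists (seq_mset s) => //.
  by rewrite (perm_big _ (perm_eq_seq_mset s)) prodE sn.
Qed.

(** * Adjoining a generator to the squares of primes *)

(** The exponent [j = 0] is excluded: there [n = m] would give difference 0. *)
Definition powers_repel_squares (R : realType) (alpha : R) :=
  forall j n m : nat, (0 < j)%N -> (0 < n)%N -> (0 < m)%N ->
    1 <= `|alpha ^+ j * n%:R ^+ 2 - m%:R ^+ 2|.

(** An integer [alpha] fails at [j = 2], [n = 1], because [alpha ^+ 2] is then itself a square. *)
Lemma powers_repel_squares_nint (R : realType) (alpha : R) :
  1 < alpha -> powers_repel_squares alpha -> alpha \isn't a Num.int.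
Proof.
move=> a1 asep; apply/negP; rewrite intrEge0 ?(le_trans ler01 (ltW a1))//.
move=> /natrP[m am]; have m0 : (0 < m)%N.
  by rewrite -(ltr0n R) -am (lt_trans ltr01).
have := asep 2%N 1%N m isT isT m0.
by rewrite expr1n mulr1 am subrr normr0 ler10.
Qed.

(** Here [i0] is the index of [alpha], and [P i] is the prime with square [g i], completed by
    [P i0 = 1]; every product thus splits into a power of [alpha] and a square. The listing [g] is
    arbitrary, since one direction of the characterization is handed an unknown one. *)
Lemma adjoin_prime_squares (R : realType) (alpha : R) (g : nat -> R) :
  ~ prime_squares R alpha -> injective g ->
  range g = prime_squares R `|` [set alpha] ->
  exists i0 (P : nat -> nat), [/\ injective P,
    forall i, P i = 1%N \/ prime (P i),
    forall i, prime (P i) = (i != i0),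
    forall s : seq nat, \prod_(i <- s) g i =
      alpha ^+ count_mem i0 s * (\prod_(i <- s) P i)%N%:R ^+ 2 &
    forall k n, (0 < n)%N -> exists2 A : {mset nat}%mset,
      A i0 = k & \prod_(i <- A) g i = alpha ^+ k * n%:R ^+ 2].
Proof.
move=> aG ginj gG.
have [i0 _ gi0] : range g alpha by rewrite gG; right.
have /choice[P PP] i : exists p,
    (i = i0 /\ p = 1%N) \/ [/\ i != i0, prime p & g i = p%:R ^+ 2].
  have : range g (g i) by exists i.
  rewrite gG => -[[p pr pgi]|/= gia].
    exists p; right; split => //; apply/eqP => ii0.
    by apply: aG; exists p => //; rewrite pgi ii0.
  by exists 1%N; left; split => //; apply: ginj; rewrite gia gi0.
have Ppr i : prime (P i) = (i != i0).
  by have [[-> ->]|[-> -> _]] := PP i; rewrite ?eqxx.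
have P1 i : P i = 1%N \/ prime (P i).
  by have [[_ ->]|[_ pr _]] := PP i; [left|right].
have Psurj p : prime p -> exists i, P i = p.
  move=> pr; have [i _ gi] : range g (p%:R ^+ 2) by rewrite gG; left; exists p.
  exists i; have [[ii0 _]|[_ _ /eqP]] := PP i.
    by case: aG; exists p => //; rewrite -gi ii0.
  by rewrite gi eqrXn2// eqr_nat => /eqP.
have gE (s : seq nat) : \prod_(i <- s) g i =
    alpha ^+ count_mem i0 s * (\prod_(i <- s) P i)%N%:R ^+ 2.
  elim: s => [|i s IHs]; first by rewrite !big_nil expr1n mulr1.
  rewrite !big_cons IHs natrM exprMn /= exprD.
  have [[-> ->]|[/negPf-> _ ->]] := PP i; last by rewrite expr0; ring.
  by rewrite eqxx gi0; ring.
exists i0, P; split => //.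
- move=> i j Pij; have := Ppr i; rewrite Pij Ppr.
  have [[-> _]|[-> _ gi]] := PP i; have [[-> _]|[-> _ gj]] := PP j => //;
    rewrite ?eqxx// => _.
  by apply: ginj; rewrite gi gj Pij.
- move=> k n n0; have [s sP sn] := exists_prod_seq Psurj n0.
  have Pi0 : P i0 = 1%N by have [//|] := P1 i0; rewrite Ppr eqxx.
  have si0 : count_mem i0 s = 0%N.
    apply/eqP; rewrite -leqn0 leqNgt -has_count; apply/hasP => -[i si /eqP ii0].
    by move: (allP sP i si); rewrite /= Ppr ii0 eqxx.
  (* The [k] copies of [i0] supply the power of [alpha]; the prime factorization [s] of [n] avoids
     [i0]. *)
  have kE : count_mem i0 (nseq k i0 ++ s) = k.
    by rewrite count_cat si0 addn0 count_nseq /= eqxx mul1n.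
  exists (seq_mset (nseq k i0 ++ s)); first by rewrite mset_seqE.
  rewrite (perm_big _ (perm_eq_seq_mset _)) gE kE big_cat /= sn big_nseq Pi0.
  by rewrite iter_muln exp1n !mul1n.
Qed.

(** Factoring out the smaller power of [alpha], which is at least 1, leaves either an instance of
    the hypothesis or, for equal exponents, a difference of two distinct integer squares. *)
Lemma powers_repel_squares_dist (R : realType) (alpha : R) (k l n m : nat) :
  1 < alpha -> powers_repel_squares alpha -> (0 < n)%N -> (0 < m)%N ->
  (k, n) != (l, m) ->
  1 <= `|alpha ^+ k * n%:R ^+ 2 - alpha ^+ l * m%:R ^+ 2|.
Proof.
move=> a1 asep n0 m0.
wlog kl : k l n m n0 m0 / (k <= l)%N.
  move=> wlg knlm; have [kl|/ltnW lk] := leqP k l; first exact: wlg.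
  by rewrite distrC; apply: (wlg l k m n); rewrite // eq_sym.
move=> knlm; rewrite -(subnKC kl) exprD -mulrA -mulrBr normrM.
have ak : 1 <= alpha ^+ k by rewrite exprn_ege1// ltW.
rewrite (le_trans _ (ler_peMl _ _))//; last by rewrite ger0_norm// (le_trans ler01).
rewrite distrC; have [|kl'] := posnP (l - k); last exact: asep.
move=> lk0; have {}kl : k = l by lia.
move: knlm; rewrite lk0 expr0 mul1r xpair_eqE kl eqxx/= => nm.
rewrite -!natrX.
have nm2 : (m ^ 2)%:Z - (n ^ 2)%:Z != 0 :> int.
  by rewrite subr_eq0 eqz_nat eqn_exp2r// eq_sym.
have -> : (m ^ 2)%:R - (n ^ 2)%:R = ((m ^ 2)%:Z - (n ^ 2)%:Z)%:~R :> R.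
  by rewrite rmorphB.
by rewrite -intr_norm ler1z -gtz0_ge1 normr_gt0.
Qed.

Lemma well_spaced_dist (R : realType) (b : nat -> R) (i j : nat) :
  well_spaced b -> i != j -> 1 <= `|b i - b j|.
Proof.
move=> bsp; wlog ij : i j / (i < j)%N.
  move=> wlg; rewrite neq_ltn => /orP[] ij; last rewrite distrC;
    by apply: wlg; rewrite // neq_ltn ij.
move=> _; rewrite distrC; apply: le_trans (ler_norm _); rewrite -(subnKC ij).
elim: (j - i.+1)%N => [|d IHd]; first by rewrite addn0.
by rewrite addnS; have := bsp (i.+1 + d)%N; lra.
Qed.

(** Forwards, the two numbers compared are values of distinct multisets, hence terms of [b] at
    distinct indices. Backwards, the set of all values is separated, so it can be enumerated, and no
    value is taken twice. *)
Lemma spacing_preserving_prime_squaresP (R : realType) (alpha : R) :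
  1 < alpha ->
  spacing_preserving (prime_squares R) alpha <-> powers_repel_squares alpha.
Proof.
move=> a1; split.
  move=> [aint _ [b [g [_ ginj gG [_ [phi [[psi phiK psiK] bphi]]]]]] bsp].
  have aG : ~ prime_squares R alpha.
    by move=> [p _ ap]; move: aint; rewrite -ap rpredX ?rpred_nat.
  have [i0 [P [_ _ _ _ gsurj]]] := adjoin_prime_squares aG ginj gG.
  move=> j n m j0 n0 m0.
  have [A Aj <-] := gsurj j n n0; have := gsurj 0%N m m0.
  rewrite expr0 mul1r => -[B B0 <-].
  rewrite -(psiK A) -(psiK B) -!bphi; apply: well_spaced_dist => //.
  (* [A] contains [i0] exactly [j > 0] times and [B] does not contain it. *)
  by apply: contraTneq j0 => AB; rewrite -Aj -(psiK A) AB psiK B0.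
move=> asep; have aint := powers_repel_squares_nint a1 asep.
have aG : ~ prime_squares R alpha.
  by move=> [p _ ap]; move: aint; rewrite -ap rpredX ?rpred_nat.
pose val (kn : nat * nat) : R := alpha ^+ kn.1 * kn.2%:R ^+ 2.
pose S := val @` [set kn | (0 < kn.2)%N].
have Ssep : separated S.
  move=> _ _ [[k n] n0 <-] [[l m] m0 <-]; rewrite /val/= => ltv.
  rewrite -[leRHS]gtr0_norm ?subr_gt0//; apply: powers_repel_squares_dist => //.
  by apply: contraTN ltv => /eqP[-> ->]; rewrite ltxx.
have S1 x : S x -> 1 <= x.
  move=> [[k n] /= n0 <-]; rewrite /val/= mulr_ege1 ?exprn_ege1 ?ler1n//.
  exact: ltW.
have S0 x : S x -> 0 <= x by move=> /S1; exact: le_trans.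
have GS : prime_squares R `|` [set alpha] `<=` S.
  move=> x [[p pr <-]|->].
    by exists (0%N, p); rewrite /val/= ?mul1r ?prime_gt0.
  by exists (1%N, 1%N); rewrite /val/= ?expr1n ?mulr1.
have G1 x : (prime_squares R `|` [set alpha]) x -> 1 < x.
  by move=> [/prime_squares_gt1|->].
(* The generators lie in [S] and inherit its separation, so the same lemma lists them too. *)
have [|||g [gincr gG _]] := @enum_separated R (prime_squares R `|` [set alpha]).
- by move=> x /GS/S0.
- move=> k; have [x Gx kx] := @prime_squares_unbounded R k.
  by exists x => //; left.
- by move=> x y /GS Sx /GS Sy; exact: Ssep.
have [|b [bincr bS bsp]] := enum_separated S0 _ Ssep.
  move=> k; have [x Gx kx] := @prime_squares_unbounded R k.
  by exists x => //; apply: GS; left.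
have gmono : {mono g : m n / (m <= n)%N >-> m <= n} by exact/le_mono.
have ginj : injective g := inc_inj gmono.
split=> //; exists b => //; exists g; split=> //.
  by split=> [|m n]; [apply: G1; rewrite -gG; exists 0%N|rewrite gmono].
have [i0 [P [Pinj P1 Ppr gE gsurj]]] := adjoin_prime_squares aG ginj gG.
have P0 i : (0 < P i)%N by have [->|/prime_gt0] := P1 i.
have prodP0 (s : seq nat) : (0 < \prod_(i <- s) P i)%N by exact: prodn_gt0.
have valinj (kn lm : nat * nat) : (0 < kn.2)%N -> (0 < lm.2)%N ->
    val kn = val lm -> kn = lm.
  move: kn lm => [k n] [l m] /= n0 m0 kv; apply/eqP; apply/negPn/negP.
  move=> /(powers_repel_squares_dist a1 asep n0 m0).
  by move: kv; rewrite /val/= => ->; rewrite subrr normr0 ler10.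
apply: beurling_integers_inj => //.
  move=> A B; rewrite !gE => AB.
  have [kE nE] := valinj (_, _) (_, _) (prodP0 A) (prodP0 B) AB.
  apply/msetP => i; rewrite -!count_mem_mset; have [->//|ii0] := eqVneq i i0.
  have Pi : prime (P i) by rewrite Ppr.
  by rewrite -!(logn_prod_seq _ Pinj P1 Pi) nE.
rewrite bS; apply/seteqP; split=> [_ [A _ <-]|_ [[k n] /= n0 <-]].
  by rewrite gE; exists (count_mem i0 A, \prod_(i <- A) P i)%N => //=.
by have [A _ gA] := gsurj k n n0; exists A.
Qed.

(** * Squares of quadratic units *)

(** After division by the gcd, equality makes [n] divide [m ^ 2], so [n = 1] by coprimality; then
    [m] divides 1, and [t = 2] remains. *)
Lemma quadratic_form_neq0 (t n m : nat) : (2 < t)%N -> (0 < n)%N ->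
  (n ^ 2 + m ^ 2)%N <> (n * m * t)%N.
Proof.
wlog nm : n m / coprime n m.
  move=> wlg t2 n0 nmt; have d0 : (0 < gcdn n m)%N by rewrite gcdn_gt0 n0.
  have [/dvdnP[n' nE] /dvdnP[m' mE]] := (dvdn_gcdl n m, dvdn_gcdr n m).
  apply: (wlg n' m') => //; last 1 first.
  - apply/eqP; rewrite -(@eqn_pmul2r (gcdn n m ^ 2)) ?expn_gt0 ?d0//; apply/eqP.
    by move: nmt nE mE; move: (gcdn n m) => d + nE mE; rewrite nE mE; lia.
  - by rewrite /coprime -(@eqn_pmul2r (gcdn n m))// muln_gcdl -nE -mE mul1n.
  - by move: n0; rewrite {1}nE muln_gt0 => /andP[].
move=> t2 n0 nmt.
have n1 : n = 1%N.
  apply/eqP; rewrite -dvdn1 -(Gauss_dvdr _ (coprimeXr 2 nm)) muln1.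
  by rewrite -(dvdn_addr _ (dvdn_exp (isT : 0 < 2)%N (dvdnn n))) nmt -mulnA dvdn_mulr.
have m1 : m = 1%N.
  apply/eqP; move: nmt; rewrite n1 => nmt; rewrite -dvdn1.
  rewrite -(dvdn_addl _ (dvdn_exp (isT : 0 < 2)%N (dvdnn m))) -[1%N](exp1n 2) nmt.
  by rewrite mul1n dvdn_mulr.
by move: nmt; rewrite n1 m1; lia.
Qed.

(** The power sums satisfy T(j+2) = t T(j+1) - T(j), so induction carries two consecutive ones.
    Carrying [a < b] as well keeps the natural subtraction exact and the sequence increasing. *)
Lemma trace_exp_nat (R : realType) (x y : R) (t j : nat) :
  x + y = t%:R -> x * y = 1 -> (2 < t)%N ->
  exists a b : nat, [/\ (2 <= a < b)%N, x ^+ j + y ^+ j = a%:R &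
    x ^+ j.+1 + y ^+ j.+1 = b%:R].
Proof.
move=> xyt xy1 t2; elim: j => [|j [a [b [ab aE bE]]]].
  by exists 2%N, t; rewrite t2 !expr0 !expr1 xyt -natr1.
exists b, (t * b - a)%N; split=> //; first by nia.
rewrite natrB; last by nia.
rewrite natrM -aE -bE -xyt.
transitivity ((x + y) * (x ^+ j.+1 + y ^+ j.+1) - x * y * (x ^+ j + y ^+ j)).
  by rewrite !exprS; ring.
by rewrite xy1 mul1r.
Qed.

Lemma powers_repel_squares_sqr (R : realType) (t : nat) (x y : R) :
  (2 < t)%N -> x + y = t%:R -> x * y = 1 -> y <= x ->
  powers_repel_squares (x ^+ 2).
Proof.
move=> t2 xyt xy1 yx [//|j] n m _ n0 m0.
have t0 : 0 < t%:R :> R by rewrite ltr0n ltnW// ltnW.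
have x0 : 0 < x by lra.
have y0 : 0 < y by rewrite -(pmulr_rgt0 _ x0) xy1.
(* As [j] here is the predecessor of the exponent, the trace needed is the second one, which exceeds
   2. *)
have [a [T [/andP[a2 /(leq_ltn_trans a2) T2] _ TE]]] := trace_exp_nat j xyt xy1 t2.
move: (j.+1) TE => {}j TE.
have uy : 0 < y ^+ j by rewrite exprn_gt0.
have uyx : y ^+ j <= x ^+ j by rewrite lerXn2r// nnegrE ltW.
have uv1 : x ^+ j * y ^+ j = 1 by rewrite -exprMn xy1 expr1n.
rewrite -exprM mulnC exprM; move: (x ^+ j) (y ^+ j) TE uy uyx uv1 => u v TE v0 vu uv1.
rewrite -exprMn subr_sqr normrM.
have n0' : 0 < n%:R :> R by rewrite ltr0n.
have m0' : 0 < m%:R :> R by rewrite ltr0n.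
(* Trading the factor [u n + m] for the conjugate [v n - m] only lowers the product and turns it
   into an integer. *)
have vn : `|v * n%:R - m%:R| <= `|u * n%:R + m%:R|.
  have vn0 : 0 < v * n%:R by rewrite mulr_gt0.
  have vun : v * n%:R <= u * n%:R by rewrite ler_pM2r.
  by rewrite [leRHS]gtr0_norm ?ler_norml; lra.
apply: le_trans (ler_wpM2l (normr_ge0 _) vn); rewrite -normrM.
have -> : (u * n%:R - m%:R) * (v * n%:R - m%:R) =
    ((n ^ 2 + m ^ 2)%:Z - (n * m * T)%:Z)%:~R.
  rewrite rmorphB /= -!pmulrn natrD !natrX !natrM -TE.
  transitivity (u * v * n%:R ^+ 2 + m%:R ^+ 2 - n%:R * m%:R * (u + v)); first by ring.
  by rewrite uv1 mul1r.
rewrite -intr_norm ler1z -gtz0_ge1 normr_gt0 subr_eq0 eqz_nat.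
by apply/eqP; exact: quadratic_form_neq0.
Qed.

(** The number is the square of the larger root of X^2 - tX + 1. The last clause recovers [t] from
    [a], so different [t] yield different numbers. *)
Lemma exists_repelling (R : realType) (t : nat) : (2 < t)%N ->
  exists a : R, [/\ 1 < a, powers_repel_squares a & a + a^-1 = t%:R ^+ 2 - 2].
Proof.
move=> t2; pose s := Num.sqrt (t%:R ^+ 2 - 4) : R.
have t3 : 3 <= t%:R :> R by rewrite ler_nat.
have s2 : s ^+ 2 = t%:R ^+ 2 - 4 by rewrite sqr_sqrtr//; nra.
have s0 : 0 < s by rewrite sqrtr_gt0; nra.
pose x := (t%:R + s) / 2; pose y := (t%:R - s) / 2.
have xyt : x + y = t%:R by rewrite /x /y; field.
have xy1 : x * y = 1.
  transitivity ((t%:R ^+ 2 - s ^+ 2) / 4); first by rewrite /x /y; field.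
  by rewrite s2; field.
have yx : y <= x by rewrite /x /y; lra.
have x1 : 1 < x by rewrite /x; lra.
exists (x ^+ 2); split.
- by rewrite exprn_egt1.
- exact: powers_repel_squares_sqr t2 xyt xy1 yx.
- have -> : (x ^+ 2)^-1 = y ^+ 2.
    rewrite -exprVn; congr (_ ^+ 2); rewrite -[LHS]mulr1 -xy1 mulKf//.
    by rewrite gt_eqF// (lt_trans ltr01).
  transitivity ((x + y) ^+ 2 - 2 * (x * y)); first by ring.
  by rewrite xyt xy1 mulr1.
Qed.

(** * Measure zero *)

(** Pigeonhole: the fractional parts of the [N + 1] multiples [k x], [k <= N], fall into [N] boxes
    of length [1/N], so two share a box. *)
Lemma dirichlet_approx (R : realType) (x : R) (N : nat) : (0 < N)%N ->
  exists (n : nat) (m : int), [/\ (0 < n)%N, (n <= N)%N &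
    `|n%:R * x - m%:~R| <= N%:R^-1].
Proof.
move=> N0; have N0R : 0 < N%:R :> R by rewrite ltr0n.
pose frac k := k%:R * x - (Num.floor (k%:R * x))%:~R.
have frac0 k : 0 <= frac k by rewrite subr_ge0 ge_floor.
have frac1 k : frac k < 1 by rewrite ltrBlDl; by have := floorD1_gt (k%:R * x); rewrite intrD1.
have boxlt k : (Num.truncn (N%:R * frac k) < N)%N.
  by rewrite truncn_lt_nat ?mulr_ge0// gtr_pMr.
pose box (k : 'I_N.+1) := Ordinal (boxlt k).
have /injectivePn[i [j ij boxij]] : ~~ injectiveb box.
  apply/negP => /injectiveP /leq_card; rewrite !card_ord ltnn//.
wlog ltij : i j ij boxij / (i < j)%N.
  move=> wlg; have := ij; rewrite -val_eqE neq_ltn => /orP[] lt; first exact: (wlg i j).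
  by apply: (wlg j i); rewrite // eq_sym.
exists (j - i)%N, (Num.floor (j%:R * x) - Num.floor (i%:R * x)); split.
- by rewrite subn_gt0.
- by rewrite (leq_trans (leq_subr _ _))// -ltnS.
have -> : (j - i)%:R * x - (Num.floor (j%:R * x) - Num.floor (i%:R * x))%:~R =
    frac j - frac i.
  by rewrite natrB ?(ltnW ltij)// rmorphB /frac /=; ring.
rewrite -(ler_pM2l N0R) divff ?gt_eqF// -{1}(gtr0_norm N0R) -normrM mulrBr.
have trE : Num.truncn (N%:R * frac i) = Num.truncn (N%:R * frac j).
  by have /(congr1 val) := boxij.
have pi : 0 <= N%:R * frac i by rewrite mulr_ge0.
have pj : 0 <= N%:R * frac j by rewrite mulr_ge0.
have := truncn_eq_lt1 pi (esym trE); have := truncn_eq_lt1 pj trE.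
rewrite ler_norml; lra.
Qed.

(** The case [j = 2] of [powers_repel_squares], as an intersection of closed conditions and hence
    measurable. *)
Definition square_distant (R : realType) : set R :=
  [set x | forall n m : nat, (0 < n)%N -> (0 < m)%N ->
    1 <= `|(x * n%:R) ^+ 2 - m%:R ^+ 2|].
Arguments square_distant : clear implicits.

Lemma closed_square_distant (R : realType) : closed (square_distant R).
Proof.
rewrite [X in closed X](_ : _ = \bigcap_(n in [set n | 0 < n]%N)
  \bigcap_(m in [set m | 0 < m]%N)
    (fun x : R => `|(x * n%:R) ^+ 2 - m%:R ^+ 2|) @^-1` [set y | 1 <= y]); last first.
  by apply/seteqP; split=> x /= xP n => [n0 m m0|m n0 m0]; apply: xP.
apply: closed_bigI => n _; apply: closed_bigI => m _.
apply: closed_comp; last exact: closed_ge.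
move=> x _; apply: cvg_norm; apply: cvgB; last exact: cvg_cst.
apply: cvgM; apply: cvgMl; exact: cvg_id.
Qed.

(* Dirichlet gives z = m/n with n <= N, and then r = 1/(nN). *)
Lemma square_distant_hole (R : realType) (x : R) (N : nat) : 1 < x -> (1 < N)%N ->
  exists (r z : R), [/\ 0 < r, r <= N%:R^-1, `|x - z| <= r &
    square_distant R `&` ball z (r / (6 * x)) = set0].
Proof.
move=> x1 N1; have N0 : (0 < N)%N by exact: ltnW.
have [n [m [n0 nN nmx]]] := dirichlet_approx x N0.
have N0R : 0 < N%:R :> R by rewrite ltr0n.
have n0R : 0 < n%:R :> R by rewrite ltr0n.
have n1R : 1 <= n%:R :> R by rewrite ler1n.
have N2R : N%:R^-1 <= 2^-1 :> R by rewrite lef_pV2 ?posrE// ler_nat.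
have x0 : 0 < x by exact: lt_trans x1.
exists (n%:R * N%:R)^-1, (m%:~R / n%:R); split.
- by rewrite invr_gt0 mulr_gt0.
- by rewrite lef_pV2 ?posrE ?mulr_gt0// ler_peMl// ltW.
- rewrite -(ler_pM2l n0R) -{1}(gtr0_norm n0R) -normrM mulrBr mulrCA divff ?gt_eqF// mulr1.
  by rewrite invfM mulrA divff ?gt_eqF// mul1r.
(* Since [n x > 1] and the error is at most 1/2, the numerator is positive, as [square_distant]
   demands. *)
have m0 : 0 < m.
  rewrite -(ltr0z R); move: nmx; rewrite ler_norml => /andP[_].
  have : 1 < n%:R * x by rewrite (lt_le_trans x1)// ler_peMl// ltW.
  lra.
case: m m0 nmx => // m m0 nmx; rewrite -pmulrn in nmx *.
apply/seteqP; split=> // y [/(_ n m n0 m0) + ].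
rewrite /ball/= => dist yz; move: dist; apply/negP; rewrite -ltNge.
(* The difference of squares is [w (w + 2m)]: the first factor is below [1/(6Nx)] in absolute value,
   the second is at most [6Nx]. *)
pose w : R := y * n%:R - m%:R.
have wlt : `|w| * (6 * (N%:R * x)) < 1.
  have -> : `|w| = `|m%:R / n%:R - y| * n%:R.
    rewrite -{2}(gtr0_norm n0R) -normrM mulrBl mulfVK ?gt_eqF//.
    by rewrite /w distrC.
  rewrite [ltRHS](_ : 1 = (n%:R * N%:R)^-1 / (6 * x) * n%:R * (6 * (N%:R * x))).
    by rewrite ltr_pM2r ?mulr_gt0// ltr_pM2r.
  by field; rewrite !gt_eqF.
have w0 := normr_ge0 w.
have Nx1 : 1 < N%:R * x by rewrite (lt_le_trans x1)// ler_peMl ?ler1n// ltW.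
have nNx : n%:R * x <= N%:R * x by rewrite ler_pM2r// ler_nat.
have w1 : `|w| <= 1.
  rewrite (le_trans _ (ltW wlt))// ler_peMr//; lra.
have -> : (y * n%:R) ^+ 2 - m%:R ^+ 2 = w * (w + 2 * m%:R) by rewrite /w; ring.
rewrite normrM (le_lt_trans _ wlt)// ler_wpM2l//.
have m0R : 0 <= m%:R :> R by [].
have mnx : m%:R <= n%:R * x + 2^-1 by move: nmx; rewrite ler_norml; lra.
rewrite (le_trans (ler_normD _ _))// [X in _ + X]ger0_norm ?mulr_ge0//.
lra.
Qed.

(** * Lebesgue density *)

Lemma measure_complement_le (R : realType) (E : set R) (x z r s : R) :
  measurable E -> 0 <= s -> ball z s `<=` ball x r -> E `&` ball z s = set0 ->
  0 <= r -> (lebesgue_measure (E `&` ball x r) <= (r *+ 2 - s *+ 2)%:E)%E.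
Proof.
move=> mE s0 zx Ez r0.
have mb y t : measurable (ball (y : R) t) by exact: measurable_ball.
rewrite EFinB -(lebesgue_measure_ball x r0) -(lebesgue_measure_ball z s0).
rewrite -[X in (_ - lebesgue_measure X)%E](setIidr zx) -measureD.
- apply: le_measure; rewrite ?inE.
  + by apply: measurableI => //; exact: mb.
  + by apply: measurableD; exact: mb.
  move=> y [Ey xy]; split=> // zy.
  by have : (E `&` ball z s) y by []; rewrite Ez.
- exact: mb.
- exact: mb.
- by rewrite /= lebesgue_measure_ball// ltry.
Qed.

(** Almost every point of a measurable set is a density point of it. But the ball of radius [2r]
    around [x] contains a missed ball of radius [c r], which keeps the density at most [1 - c/2] for
    arbitrarily small [r]. *)
Lemma square_distant_negligible (R : realType) :
  (@lebesgue_measure R).-negligible (square_distant R `&` [set x | 1 < x]).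
Proof.
have mE : measurable (square_distant R).
  by apply: closed_measurable; exact: closed_square_distant.
have := lebesgue_density mE; apply: negligibleS => x [Ex /= x1] /=.
rewrite indicE mem_set//= => dens.
have x0 : 0 < x by exact: lt_trans x1.
pose c := (6 * x)^-1; have c0 : 0 < c by rewrite invr_gt0 mulr_gt0.
have c1 : c < 1 by rewrite invf_lt1 ?mulr_gt0//; lra.
have : nbhs (1%:E : \bar R) [set y | ((1 - c / 2)%:E < y)%E].
  apply: open_nbhs_nbhs; split; first exact: open_ereal_gt_ereal.
  by rewrite /= lte_fin gtrBl divr_gt0.
move=> /dens[e /= e0 eP].
(* This makes [N > 2/e], whence [2r < e], and also [N > 1]. *)
pose N := (Num.truncn (2 / e)).+2.
have [//|r [z [r0 rN xz hole]]] := @square_distant_hole R x N x1.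
have Ne : 2 / e < N%:R.
  by rewrite (lt_trans (truncnS_gt _))// ltr_nat.
have re : r * 2 < e.
  rewrite -ltr_pdivlMr// (le_lt_trans rN)// invf_plt ?posrE// ?divr_gt0//.
  by rewrite invf_div.
have r2 : 0 < r *+ 2 by rewrite pmulrn_rgt0.
have : ball 0 e (r *+ 2) by rewrite /ball/= sub0r normrN gtr0_norm// mulr2n; lra.
move=> /eP /(_ r2) /= dens_gt.
have zx : ball z (c * r) `<=` ball x (r *+ 2).
  move=> y; rewrite /ball/= => zy.
  have -> : x - y = (x - z) + (z - y) by ring.
  rewrite (le_lt_trans (ler_normD _ _))// mulr2n ler_ltD//.
  by rewrite (lt_trans zy)// gtr_pMl.
have [cr0 rr0] : 0 <= c * r /\ 0 <= r *+ 2 by split; rewrite ltW// mulr_gt0.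
have rr0' : 0 < r *+ 2 *+ 2 by rewrite pmulrn_rgt0.
have crhole : square_distant R `&` ball z (c * r) = set0 by rewrite mulrC.
have ball_gap := measure_complement_le mE cr0 zx crhole rr0.
move: dens_gt; rewrite ltNge => /negP; apply.
rewrite lebesgue_measure_ball// inver gt_eqF//.
apply: (@le_trans _ _ ((r *+ 2 *+ 2 - (c * r) *+ 2)%:E * (r *+ 2 *+ 2)^-1%:E)%E).
  by rewrite lee_wpmul2r// lee_fin invr_ge0 ltW.
(* Both sides agree: [(4r - 2cr) / 4r = 1 - c/2]. *)
rewrite -EFinM lee_fin !mulr2n le_eqVlt; apply/orP; left; apply/eqP.
by field; rewrite gt_eqF.
Qed.

(** [A] comes without a measurability proof; the value of [lebesgue_measure] on it is the outer
    measure, which vanishes on negligible sets. *)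
Lemma lebesgue_measure_square_distant (R : realType) (A : set R) :
  A `<=` square_distant R `&` [set x | 1 < x] -> lebesgue_measure A = 0%E.
Proof.
move=> AS; apply: (negligible_outer_measure A).1.
have := @square_distant_negligible R; apply: negligibleS.
exact: AS.
Qed.

Theorem theorem4 (R : realType) :
  [/\ beurling_integers_of (prime_squares R) (fun n : nat => n.+1%:R ^+ 2),
      infinite_set (spacing_preserving (prime_squares R)) &
      lebesgue_measure (spacing_preserving (prime_squares R)) = 0%E].
Proof.
split; first exact: beurling_integers_of_prime_squares.
  (* The shift by 3 runs through all traces above 2. *)
  have /choice[f fP] t := @exists_repelling R t.+3 isT.
  have finj : injective f.
    move=> s t fst; have [_ _] := fP s; rewrite fst; have [_ _ ->] := fP t.
    by move/addIr/eqP; rewrite eqrXn2// eqr_nat => /eqP[].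
  apply: (@sub_infinite_set _ (range f)).
    move=> _ [t _ <-]; have [ft1 ft _] := fP t.
    exact/spacing_preserving_prime_squaresP.
  rewrite (eq_finite_set (inj_card_eq (in2W finj))).
  exact: infinite_nat.
apply: lebesgue_measure_square_distant => x Sx; have [_ x1 _] := Sx.
split=> // n m n0 m0; rewrite exprMn.
by apply: (spacing_preserving_prime_squaresP x1).1.
Qed.
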